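(* Let $X$ and $Y$ be real normed spaces and let $S\colon X\to Y$ be a bounded linear operator. For every nonempty convex set $F\subseteq X$ such that $S(F)$ is bounded, and every $n\in\mathbb{N}_0$, we have \[ a_n(S,F)\;\le\;2\,e^{3/2}(n+1)^{3/2}\,h_n(S,F), \] and, if $Y$ is a Hilbert space, then \[ a_n(S,F)\;\le\;2\,e\,(n+1)\,h_n(S,F). \] If $F$ is symmetric (i.e. $F=-F$), then $a_n(S,F)\le e\,(n+1)\,h_n(S,F)$ in general, and if $Y$ is additionally a Hilbert space, then $a_n(S,F)\le\sqrt{e\,(n+1)}\;h_n(S,F)$.
   Context: $\mathcal{L}(X,Y)$ denotes the space of bounded linear operators from $X$ to $Y$ with the operator norm. $\ell_2^{k}$ is $\mathbb{R}^k$ with the Euclidean norm and $B_{\ell_2^k}$ is its closed unit ball. $\mathbb{N}_0=\{0,1,2,\dots\}$. For an operator $T\in\mathcal{L}(X,Y)$, its $n$-th approximation number is $a_n(T):=\inf\{\|T-L\| : L\in\mathcal{L}(X,Y),\ \operatorname{rank}(L)\le n\}$. For $S\in\mathcal{L}(X,Y)$ and $F\subseteq X$ nonempty and convex with $S(F)$ bounded, the approximation and Hilbert numbers of $S$ on $F$ are \[ a_n(S,F):=\inf\Bigl\{\sup_{f\in F}\|Sf-Lf-y_0\| : y_0\in Y,\ L\in\mathcal{L}(X,Y),\ \operatorname{rank}(L)\le n\Bigr\}, \] \[ h_n(S,F):=\sup\Bigl\{a_n(BSA) : A\in\mathcal{L}(\ell_2^{n+1},X)\text{ and }x\in F\text{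 with }A(B_{\ell_2^{n+1}})+x\subseteq F,\ B\in\mathcal{L}(Y,\ell_2^{n+1})\text{ with }\|B\|\le 1\Bigr\}, \] where $a_n(BSA)$ is the approximation number of the operator $BSA\in\mathcal{L}(\ell_2^{n+1},\ell_2^{n+1})$. *)

(* Defs.v *)
(* MathComp-Analysis; the reals are an abstract [R : realType]. *)
From HB Require Import structures.
From mathcomp Require Import all_boot all_order all_algebra.
From mathcomp Require Import all_classical all_reals all_analysis.
From mathcomp Require Import sesquilinear ring.
Set Implicit Arguments.
Unset Strict Implicit.
Unset Printing Implicit Defensive.
Import Order.TTheory GRing.Theory Num.Theory.
Import numFieldNormedType.Exports.
Local Open Scope classical_set_scope.
Local Open Scope ring_scope.

(* An alias is needed because the library norms ['rV[R]_k] by the maximum. *)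
Definition ell2 (R : realType) (k : nat) : Type := 'rV[R]_k.

HB.instance Definition _ (R : realType) (k : nat) :=
  GRing.Lmodule.copy (ell2 R k) 'rV[R]_k.

Section ell2_norm.
Variables (R : realType) (k : nat).
Implicit Types u v : 'rV[R]_k.

Definition ell2_norm u : R := Num.sqrt (\sum_(i < k) u ord0 i ^+ 2).

Let sqs u : R := \sum_(i < k) u ord0 i ^+ 2.
Let ip u v : R := \sum_(i < k) u ord0 i * v ord0 i.

Let sqs_ge0 u : 0 <= sqs u.
Proof. by apply: sumr_ge0 => i _; exact: sqr_ge0. Qed.

Let sqs_eq0 u : sqs u = 0 -> u = 0.
Proof.
move=> /eqP; rewrite psumr_eq0 => [|i _]; last exact: sqr_ge0.
move=> /allP u0; apply/rowP => i; rewrite mxE; apply/eqP.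
by have := u0 i (mem_index_enum i); rewrite /= sqrf_eq0.
Qed.

Let sqs_comb (a b : R) u v :
  sqs (a *: u + b *: v) =
  a ^+ 2 * sqs u + 2 * a * b * ip u v + b ^+ 2 * sqs v.
Proof.
rewrite /sqs /ip !mulr_sumr -!big_split /=; apply: eq_bigr => i _.
by rewrite !mxE; ring.
Qed.

Let ip_le u v : ip u v <= ell2_norm u * ell2_norm v.
Proof.
rewrite -sqrtrM -/(sqs _)//; apply: (le_trans (ler_norm _)).
rewrite -sqrtr_sqr; apply: ler_wsqrtr; rewrite -/(sqs v).
have [/[dup] /sqs_eq0 v0 ->|v_gt0] := eqVneq (sqs v) 0.
  rewrite mulr0 /ip big1 ?expr0n// => i _.
  by rewrite v0 mxE mulr0.
have {}v_gt0 : 0 < sqs v by rewrite lt_def v_gt0 sqs_ge0.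
rewrite -subr_ge0 -(pmulr_rge0 _ v_gt0).
have := sqs_ge0 (sqs v *: u + (- ip u v) *: v); rewrite sqs_comb.
by congr (_ <= _); ring.
Qed.

Let ler_ell2D u v : ell2_norm (u + v) <= ell2_norm u + ell2_norm v.
Proof.
rewrite -[leRHS]ger0_norm ?addr_ge0 ?sqrtr_ge0// -sqrtr_sqr.
apply: ler_wsqrtr; rewrite -/(sqs _) -[u]scale1r -[v]scale1r sqs_comb !scale1r.
rewrite sqrrD !sqr_sqrtr ?sqs_ge0// expr1n !mul1r mulr1.
by rewrite lerD2r lerD2l mulr1 -[leRHS]mulr_natl ler_pM2l ?ltr0n ?ip_le.
Qed.

Let ell2Z (a : R) u : ell2_norm (a *: u) = `|a| * ell2_norm u.
Proof.
rewrite /ell2_norm -sqrtr_sqr -sqrtrM ?sqr_ge0// mulr_sumr.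
by congr Num.sqrt; apply: eq_bigr => i _; rewrite mxE exprMn.
Qed.

Let ell20_eq0 u : ell2_norm u = 0 -> u = 0.
Proof.
move=> /eqP; rewrite sqrtr_eq0 => u0; apply: sqs_eq0.
by apply/eqP; rewrite eq_le u0 sqs_ge0.
Qed.

HB.instance Definition _ :=
  Lmodule_isNormed.Build R (ell2 R k) ler_ell2D ell2Z ell20_eq0.

End ell2_norm.

Section operators.
Variables (R : realType) (X Y : normedModType R).

Definition bounded_op (T : {linear X -> Y}) : Prop := bounded_near T (nbhs 0).

(* The values lie in [\bar R] since suprema of unbounded sets are [+oo]. *)
Definition opnorm (T : X -> Y) : \bar R :=
  ereal_sup [set `|T x|%:E | x in [set x | `|x| <= 1]].

(* [range L], being a subspace, has dimension at most [n] exactly when it is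
   spanned by a family of [n] (not necessarily independent) vectors. *)
Definition rank_le (n : nat) (L : {linear X -> Y}) : Prop :=
  exists v : 'I_n -> Y,
    range L = [set \sum_(i < n) c i *: v i | c in [set: 'I_n -> R]].

Definition finite_rank_ops (n : nat) : set {linear X -> Y} :=
  [set L | bounded_op L /\ rank_le n L].

Definition approx_number (n : nat) (T : {linear X -> Y}) : \bar R :=
  ereal_inf [set opnorm (T \- L) | L in finite_rank_ops n].

Definition approx_number_on (n : nat) (S : {linear X -> Y}) (F : set X) :
    \bar R :=
  ereal_inf [set ereal_sup [set `|S f - L f - y0|%:E | f in F] |
             y0 in [set: Y] & L in finite_rank_ops n].

End operators.

Definition hilbert_number (R : realType) (X Y : normedModType R) (n : nat)
    (S : {linear X -> Y}) (F : set X) : \bar R :=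
  ereal_sup [set h | exists (A : {linear ell2 R n.+1 -> X}) (x : X)
                            (B : {linear Y -> ell2 R n.+1}),
    [/\ bounded_op A,
        F x /\ [set A u + x | u in [set u | `|u| <= 1]] `<=` F,
        bounded_op B,
        (opnorm B <= 1)%E &
        h = approx_number n (B \o S \o A)]].

Definition is_hilbert (R : realType) (Y : normedModType R) : Prop :=
  (forall G : set_system Y, ProperFilter G -> cauchy G -> cvg G) /\
  exists dot : {dot Y for idfun}, forall y : Y, dot y y = `|y| ^+ 2.

(* Main.v *)
Require Import Defs.
From HB Require Import structures.
From mathcomp Require Import all_boot all_order all_algebra.
From mathcomp Require Import all_classical all_reals all_analysis.
From mathcomp Require Import perm sesquilinear ring lra.
Set Implicit Arguments.
Unset Strict Implicit.
Import Order.TTheory GRing.Theory Num.Theory.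
Import numFieldNormedType.Exports.
Local Open Scope classical_set_scope.
Local Open Scope ring_scope.

(* Let [D k] be the supremum of [|det (B S A)|] over contractions
   [B : Y -> ell2 k] and maps [A : ell2 k -> X] sending the unit ball, up to a
   translation, into [F].  Deleting the input direction [u] and the output
   direction [B S A u] from a map of size [n + 1] leaves a map of size [n], so
   [|det (B S A)| <= |B S A u| * D n] for every unit vector [u].  Conversely, if
   [f] nearly attains the error on [F] of the rank [k] interpolation (orthogonal
   projection in the Hilbert case) built from [A] and [B], then adding [f] to [A]
   and a functional norming the residual to [B] gives
   [D (k + 1) >= c k * a_k(S, F) * D k].  For a near-maximal map of size [n]
   extended in this way, the lower bound of [B S A] on unit vectors is therefore
   about [c n * a_n(S, F)].  The constant [c n] comes from rescaling [A] and [B]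
   to keep them admissible. *)

(** * Preliminaries on linear maps, boundedness and convexity *)

Lemma linear_existsP (R : pzRingType) (U V : lmodType R) (f : U -> V) :
  linear f -> exists g : {linear U -> V}, g =1 f.
Proof.
move=> lf; pose m := GRing.isLinear.Build R U V _ f lf.
pose g : {linear U -> V} := HB.pack f m.
by exists g.
Qed.

Lemma bounded_opP (R : realType) (X Y : normedModType R)
    (T : {linear X -> Y}) :
  bounded_op T <-> exists2 M, 0 <= M & forall x, `|T x| <= M * `|x|.
Proof.
rewrite /bounded_op linear_boundedP; split.
  case=> M [Mr HM]; exists (Num.max 0 (M + 1)); first by rewrite le_max lexx.
  by apply: HM; rewrite lt_max ltrDl ltr01 orbT.
case=> M M0 HM; exists M; split; first by rewrite ger0_real.
move=> r Mr x; apply: (le_trans (HM x)).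
by rewrite ler_wpM2r// ltW.
Qed.

Lemma convex_setE (R : realType) (X : lmodType R) (F : set X) :
  convex_set (F : set (convex_lmodType X)) ->
  forall x y t, F x -> F y -> 0 <= t <= 1 -> F (t *: x + (1 - t) *: y).
Proof.
move=> cF x y t Fx Fy t01.
have := cF x y (Itv01 (andP t01).1 (andP t01).2).
by rewrite !inE; apply.
Qed.

(** * The Hahn-Banach theorem for a norm *)

Section HahnBanach.
Variables (R : realType) (Y : normedModType R).

(* A linear functional dominated by the norm, given by its graph on a subspace:
   the domination makes the relation functional. *)
Definition dominated_graph (G : set (Y * R)) :=
  (forall a p q, G p -> G q -> G (a *: p.1 + q.1, a * p.2 + q.2)) /\
  (forall p, G p -> p.2 <= `|p.1|).

Lemma dominated_graph_fun (G : set (Y * R)) y r s :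
  dominated_graph G -> G (y, r) -> G (y, s) -> r = s.
Proof.
move=> [lG dG]; have aux u v : G (y, u) -> G (y, v) -> u <= v.
  move=> Gu Gv; have /dG/= := lG (-1) _ _ Gv Gu.
  by rewrite scaleN1r addNr normr0 mulN1r addrC subr_le0.
by move=> Gr Gs; apply/eqP; rewrite eq_le !aux.
Qed.

(** The value [c] at [v] must satisfy [p.2 - |p.1 - v| <= c <= |q.1 + v| - q.2] for all [p], [q] in
    [G]. The triangle inequality puts every lower bound below every upper bound, so the supremum of
    the lower ones works. *)
Lemma dominated_graph_extend (G : set (Y * R)) (v : Y) :
  dominated_graph G -> G !=set0 ->
  exists G', [/\ dominated_graph G', G `<=` G' & exists c, G' (v, c)].
Proof.
move=> [lG dG] [p0 Gp0].
have G0 : G (0, 0).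
  by have := lG (-1) _ _ Gp0 Gp0; rewrite scaleN1r mulN1r !addNr.
have sG p : G p -> forall a, G (a *: p.1, a * p.2).
  by move=> Gp a; have := lG a _ _ Gp G0; rewrite !addr0.
pose E := [set p.2 - `|p.1 - v| | p in G].
have Eub p q : G p -> G q -> p.2 - `|p.1 - v| <= `|q.1 + v| - q.2.
  move=> Gp Gq; have /dG/= := lG 1 _ _ Gp Gq.
  rewrite scale1r mul1r => h.
  have := ler_normD (p.1 - v) (q.1 + v).
  have -> : (p.1 - v) + (q.1 + v) = p.1 + q.1 by rewrite addrACA addNr addr0.
  by lra.
have supE : has_sup E.
  split; first by exists (p0.2 - `|p0.1 - v|); exists p0.
  by exists (`|p0.1 + v| - p0.2) => _ [p Gp <-]; exact: Eub.
pose c := sup E.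
have c1 p : G p -> p.2 - c <= `|p.1 - v|.
  move=> Gp; have : p.2 - `|p.1 - v| <= c by apply: (ub_le_sup supE.2); exists p.
  by lra.
have c2 p : G p -> p.2 + c <= `|p.1 + v|.
  move=> Gp; have : c <= `|p.1 + v| - p.2.
    by apply: (ge_sup supE.1) => _ [q Gq <-]; exact: Eub.
  by lra.
exists [set q | exists p t, G p /\ q = (p.1 + t *: v, p.2 + t * c)]; split.
- split=> [a _ _ [p [t [Gp ->]]] [q [s [Gq ->]]]|_ [p [t [Gp ->]]]] /=.
    exists (a *: p.1 + q.1, a * p.2 + q.2), (a * t + s); split; first exact: lG.
    by rewrite /= scalerDr scalerDl addrACA scalerA; congr pair; ring.
  (* Dividing by [|t|] reduces the domination to [c1] when [t < 0] and to [c2] when [t > 0]. *)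
  have [t0|t0|->] := ltgtP t 0.
  + have nt : 0 < - t by lra.
    have -> : p.1 + t *: v = (- t) *: ((- t)^-1 *: p.1 - v).
      by rewrite scalerBr scalerA mulfV ?gt_eqF// scale1r scaleNr opprK.
    have -> : p.2 + t * c = (- t) * ((- t)^-1 * p.2 - c).
      by rewrite mulrBr mulrA mulfV ?gt_eqF// mul1r mulNr opprK.
    rewrite normrZ (gtr0_norm nt) ler_pM2l//.
    exact: (c1 _ (sG _ Gp _)).
  + have -> : p.1 + t *: v = t *: (t^-1 *: p.1 + v).
      by rewrite scalerDr scalerA mulfV ?gt_eqF// scale1r.
    have -> : p.2 + t * c = t * (t^-1 * p.2 + c).
      by rewrite mulrDr mulrA mulfV ?gt_eqF// mul1r.
    rewrite normrZ (gtr0_norm t0) ler_pM2l//.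
    exact: (c2 _ (sG _ Gp _)).
  + by rewrite scale0r mul0r !addr0; exact: dG.
- by move=> p Gp; exists p, 0; rewrite scale0r mul0r !addr0; split=> //; case: p Gp.
- by exists c, (0, 0), 1; rewrite scale1r mul1r !add0r.
Qed.

(** Zorn's lemma yields a maximal dominated graph through [(y0, |y0|)]; the one-dimensional
    extension forces its domain to be all of [Y]. *)
Theorem norming_functional (y0 : Y) :
  exists b : {linear Y -> R^o}, (forall y, `|b y| <= `|y|) /\ b y0 = `|y0|.
Proof.
(* The condition on [y0] is restricted to nonempty graphs because the union of the empty chain is
   empty and must satisfy [P]. *)
pose P G := dominated_graph G /\ (G !=set0 -> G (y0, `|y0|)).
have [|G [[dG G0] Gmax]] := @Zorn_bigcup _ P.
  move=> C CP Ctot; split; last first.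
    by move=> [p [G CG Gp]]; exists G => //; apply: (CP _ CG).2; exists p.
  split=> [a p q [G1 CG1 Gp] [G2 CG2 Gq]|p [G CG Gp]]; last first.
    exact: (CP _ CG).1.2.
  have [s12|s21] := Ctot _ _ CG1 CG2.
    by exists G2 => //; apply: (CP _ CG2).1.1 => //; exact: s12.
  by exists G1 => //; apply: (CP _ CG1).1.1 => //; exact: s21.
(* The graph on the line through [y0] shows that the empty graph is not maximal. *)
have line : P [set p | exists t, p = (t *: y0, t * `|y0|)].
  split; last by exists 1; rewrite scale1r mul1r.
  split=> [a _ _ [t ->] [s ->]|_ [t ->]] /=.
    by exists (a * t + s); rewrite scalerDl mulrDl scalerA mulrA.
  by rewrite normrZ ler_wpM2r// ler_norm.
have Gn0 : G !=set0.
  apply: contrapT => /set0P/negP; rewrite negbK => /eqP GE.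
  apply: (Gmax _ _ line); rewrite GE; split=> // /(_ (y0, `|y0|)); apply.
  by exists 1; rewrite scale1r mul1r.
have Gtot v : exists c, G (v, c).
  have [G' [dG' GG' [c G'c]]] := dominated_graph_extend v dG Gn0.
  exists c; have [G'G|nG'G] := pselect (G' `<=` G); first exact: G'G.
  exfalso; apply: (Gmax G'); first by split.
  by split=> // _; apply: GG'; exact: G0.
have [b Gb] := choice Gtot.
have lb : linear (b : Y -> R^o).
  move=> a u v; apply: (dominated_graph_fun dG (Gb _)).
  exact: (dG.1 a _ _ (Gb u) (Gb v)).
have [g gE] := linear_existsP lb.
exists g; split=> [y|]; last first.
  by rewrite gE; apply: (dominated_graph_fun dG (Gb _)); exact: G0.
rewrite ler_norml !gE (dG.2 _ (Gb y)) andbT lerNl.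
by have := dG.2 _ (Gb (- y)); rewrite /= normrN -gE linearN gE.
Qed.

End HahnBanach.

(** * Euclidean spaces *)

Section Ell2.
Variable R : realType.
Implicit Types k m n : nat.

Lemma mul_ell2_lin1 k m (T : {linear ell2 R k -> ell2 R m}) (u : 'rV[R]_k) :
  u *m lin1_mx (T : 'rV[R]_k -> 'rV[R]_m) = T u.
Proof. exact: (mul_rV_lin1 (T : {linear 'rV[R]_k -> 'rV[R]_m}) u). Qed.

Lemma sqr_ell2_norm k (u : ell2 R k) :
  `|u| ^+ 2 = ((u : 'rV[R]_k) *m (u : 'rV[R]_k)^T) ord0 ord0.
Proof.
rewrite [`|u|]/(ell2_norm u) sqr_sqrtr; last by apply: sumr_ge0 => i _; exact: sqr_ge0.
by rewrite mxE; apply: eq_bigr => i _; rewrite mxE.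
Qed.

Lemma sqr_ell2_row_mx k (a : R) (v : ell2 R k) :
  `|(row_mx a%:M (v : 'rV[R]_k) : ell2 R k.+1)| ^+ 2 = a ^+ 2 + `|v| ^+ 2.
Proof.
rewrite !sqr_ell2_norm (@tr_row_mx _ 1 1 k).
rewrite (@mul_row_col _ 1 1 k 1) mxE; congr (_ + _).
by rewrite tr_scalar_mx -scalar_mxM mxE expr2 mulr1n.
Qed.

Lemma ell2_norm_row_mx0 k (v : ell2 R k) :
  `|(row_mx (0 : 'rV_1) (v : 'rV[R]_k) : ell2 R k.+1)| = `|v|.
Proof.
apply/eqP; rewrite -(@eqrXn2 _ 2)// -[(0 : 'rV_1)](raddf0 (@scalar_mx R 1)).
by rewrite sqr_ell2_row_mx expr0n add0r.
Qed.

Lemma ler_ell2_coord k (u : ell2 R k) i : `|(u : 'rV[R]_k) ord0 i| <= `|u|.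
Proof.
rewrite -[leRHS]ger0_norm// -ler_sqr ?nnegrE// !real_normK ?num_real//.
rewrite sqr_ell2_norm mxE (bigD1 i)//= mxE -expr2 lerDl.
by apply: sumr_ge0 => j _; rewrite mxE -expr2 sqr_ge0.
Qed.

Lemma ell2_bounded_op k (X : normedModType R) (A : {linear ell2 R k -> X}) :
  bounded_op A.
Proof.
apply/bounded_opP; pose e i : ell2 R k := delta_mx ord0 i : 'rV[R]_k.
exists (\sum_(i < k) `|A (e i)|); first by apply: sumr_ge0.
move=> u; rewrite [in leLHS](row_sum_delta (u : 'rV[R]_k)) linear_sum mulr_suml.
apply: (le_trans (ler_norm_sum _ _ _)); apply: ler_sum => i _.
by rewrite linearZ normrZ mulrC ler_wpM2l// ler_ell2_coord.
Qed.

(* Householder reflection exchanging the first basis vector and [u]. *)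
Lemma symmetric_orthogonal_row0 n (u : ell2 R n.+1) : `|u| = 1 ->
  exists P : 'M[R]_n.+1,
    [/\ P^T = P, P *m P = 1%:M & (delta_mx ord0 ord0 : 'rV_n.+1) *m P = u].
Proof.
move=> u1; pose U : 'rV[R]_n.+1 := u; pose e : 'rV[R]_n.+1 := delta_mx 0 0.
have UU : U *m U^T = 1%:M by rewrite [LHS]mx11_scalar -sqr_ell2_norm u1 expr1n.
have eE (v : 'rV[R]_n.+1) : e *m v^T = (v 0 0)%:M.
  by rewrite [LHS]mx11_scalar -rowE !mxE.
have [uE|ue] := eqVneq U e.
  by exists 1%:M; rewrite trmx1 !mulmx1 -/e -uE.
have [w wdef] : exists w, w = U - e by eexists.
(* For unit vectors [|U - e|^2 = 2 s], so the reflection [1 - 2 w^T w / |w|^2] becomes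
   [1 - s^-1 w^T w]. *)
pose s := 1 - U 0 0.
have wwE : w *m w^T = (2 * s)%:M.
  have Ue : U *m e^T = (U 0 0)%:M.
    by rewrite -[LHS]trmxK trmx_mul trmxK eE tr_scalar_mx.
  rewrite wdef linearB /= mulmxBl !mulmxBr UU Ue !eE mxE !eqxx.
  by apply/matrixP => i j; rewrite !ord1 !mxE; rewrite /s !eqxx/=; ring.
have s0 : s != 0.
  apply: contraNneq ue => s0; rewrite -subr_eq0 -wdef; apply/eqP/rowP => i.
  rewrite [RHS]mxE; apply/eqP; rewrite -normr_eq0 eq_le normr_ge0 andbT.
  apply: le_trans (ler_ell2_coord (w : ell2 R n.+1) i) _.
  rewrite -(ler_pXn2r (_ : 0 < 2)%N) ?nnegrE// sqr_ell2_norm wwE s0 mulr0.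
  by rewrite mxE mul0rn expr0n.
exists (1%:M - s^-1 *: (w^T *m w)); split.
- by rewrite linearB linearZ /= trmx_mul trmxK trmx1.
- have WW : w^T *m w *m (w^T *m w) = (2 * s) *: (w^T *m w).
    by rewrite mulmxA -(mulmxA _ w) wwE mul_mx_scalar -scalemxAl.
  rewrite mulmxBl !mulmxBr !mul1mx mulmx1 -scalemxAl -scalemxAr WW !scalerA.
  rewrite (_ : s^-1 * s^-1 * (2 * s) = s^-1 + s^-1); last by field.
  by rewrite scalerDl opprB addrK addrNK.
- rewrite -/e mulmxBr mulmx1 -scalemxAr mulmxA eE mul_scalar_mx scalerA.
  rewrite wdef !mxE !eqxx /= -[U 0 0 - _]opprB -/s mulrN mulVf// scaleN1r opprK.
  by rewrite addrC subrK.
Qed.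

Lemma norm_det_involutive n (P : 'M[R]_n) : P *m P = 1%:M -> `|\det P| = 1.
Proof.
move=> PP; have := det_mulmx P P; rewrite PP det1 -expr2 => /esym/eqP.
by rewrite sqr_norm_eq1 => /eqP.
Qed.

Lemma ell2_norm_mul_orthogonal n (P : 'M[R]_n) (v : ell2 R n) :
  P^T = P -> P *m P = 1%:M ->
  `|((v : 'rV[R]_n) *m P : ell2 R n)| = `|v|.
Proof.
move=> PT PP; apply/eqP; rewrite -(@eqrXn2 _ 2)// !sqr_ell2_norm.
by rewrite trmx_mul PT mulmxA -(mulmxA _ P P) PP mulmx1.
Qed.

(** An operator of rank at most [n] kills some unit vector of the [(n+1)]-dimensional space, and
    there [T - L] agrees with [T]. *)
Lemma lower_bound_approx_number n (T : {linear ell2 R n.+1 -> ell2 R n.+1})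
    (s : R) :
  (forall u : ell2 R n.+1, `|u| = 1 -> s <= `|T u|) ->
  (s%:E <= approx_number n T)%E.
Proof.
move=> sT; apply: le_ereal_inf_tmp => _ [L [_ [v rL]] <-].
pose e i : ell2 R n.+1 := delta_mx ord0 i : 'rV[R]_n.+1.
have LE i : exists c : 'I_n -> R, L (e i) = \sum_(j < n) c j *: v j.
  have : range L (L (e i)) by exists (e i).
  by rewrite rL => -[c _ <-]; exists c.
have [c cE] := choice LE.
pose C : 'M[R]_(n.+1, n) := \matrix_(i, j) c i j.
have [u [u0 uC]] : exists u : 'rV[R]_n.+1, u != 0 /\ u *m C = 0.
  have : kermx C != 0.
    by rewrite -mxrank_eq0 mxrank_ker subn_eq0 -ltnNge ltnS rank_leq_col.
  move/rowV0Pn => [u /sub_kermxP uC u0]; by exists u.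
have Lu : L (u : ell2 R n.+1) = 0.
  rewrite [u]row_sum_delta linear_sum.
  under eq_bigr => i _ do rewrite linearZ /= [L _]cE scaler_sumr.
  rewrite exchange_big /= big1// => j _.
  under eq_bigr do rewrite scalerA.
  rewrite -scaler_suml; have /rowP/(_ j) := uC; rewrite !mxE => Cj.
  rewrite (_ : \sum_i _ = 0) ?scale0r// -[RHS]Cj.
  by apply: eq_bigr => i _; rewrite mxE.
pose w : ell2 R n.+1 := `|(u : ell2 R n.+1)|^-1 *: (u : ell2 R n.+1).
have w1 : `|w| = 1 by rewrite normrZ normfV normr_id mulVf// normr_eq0.
have Lw : L w = 0 by rewrite linearZ /= Lu scaler0.
apply: le_ereal_sup_tmp; exists `|T w|%:E; last by rewrite lee_fin sT.
by exists w; rewrite /= ?w1 ?Lw ?subr0.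
Qed.

End Ell2.

(** * Determinants of compressions of an operator *)

Definition op_det (R : realType) k (T : {linear ell2 R k -> ell2 R k}) : R :=
  \det (lin1_mx (T : 'rV[R]_k -> 'rV[R]_k)).

(** Crude estimate from the Leibniz formula; it serves only to make the supremum of the determinants
    finite. *)
Lemma normr_det_le (R : realType) k (M : 'M[R]_k) (K : R) :
  (forall i j, `|M i j| <= K) -> `|\det M| <= k`!%:R * K ^+ k.
Proof.
move=> MK; apply: (le_trans (ler_norm_sum _ _ _)).
apply: (@le_trans _ _ (\sum_(s : 'S_k) K ^+ k)); last first.
  by rewrite sumr_const mulr_natl -card_Sn.
apply: ler_sum => s _.
rewrite normrM normrX normrN1 expr1n mul1r normr_prod.
rewrite -[in leRHS](card_ord k) -prodr_const; apply: ler_prod => i _.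
by rewrite normr_ge0 MK.
Qed.

Section Determinants.
Variables (R : realType) (X Y : normedModType R) (S : {linear X -> Y}).
(* [Z] is the set of admissible centers: [F] itself, or [[set 0]] when [F] is
   symmetric. *)
Variables (F Z : set X).

Definition inscribed k (x : X) (A : {linear ell2 R k -> X}) :=
  [/\ Z x, F x & forall u, `|u| <= 1 -> F (A u + x)].

Definition contraction k (B : {linear Y -> ell2 R k}) :=
  forall y, `|B y| <= `|y|.

Definition attained_dets k : set R :=
  [set d | exists x (A : {linear ell2 R k -> X}) (B : {linear Y -> ell2 R k}),
    [/\ inscribed x A, contraction B & d = `|op_det (B \o S \o A)|] ].

Lemma attained_dets_bounded k : bounded_set (S @` F) ->
  has_ubound (attained_dets k).
Proof.
case=> K0 [_ SF]; pose K := K0 + 1.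
have {}SF f : F f -> `|S f| <= K.
  by move=> Ff; apply: (SF K); [rewrite ltrDl|exists f].
exists (k`!%:R * (K + K) ^+ k) => _ [x [A [B [[_ Fx AF] cB ->]]]].
apply: normr_det_le => i j; rewrite mxE.
pose e : ell2 R k := delta_mx ord0 i : 'rV[R]_k.
apply: le_trans (ler_ell2_coord (B (S (A e))) j) _.
(* [S (A e)] is the difference of the values of [S] at [A e + x] and [x], both points of [F]. *)
apply: le_trans (cB _) _; rewrite -[S (A e)](addrK (S x)) -linearD.
apply: le_trans (ler_normB _ _) _; apply: lerD; last exact: SF.
apply: SF; apply: AF; rewrite -(ler_pXn2r (_ : 0 < 2)%N) ?nnegrE//.
by rewrite expr1n sqr_ell2_norm trmx_delta mul_delta_mx mxE eqxx.
Qed.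

Lemma inscribed0 k x : Z x -> F x -> inscribed x (\0 : {linear ell2 R k -> X}).
Proof. by move=> Zx Fx; split=> // u _; rewrite add0r. Qed.

Lemma contraction0 k : contraction (\0 : {linear Y -> ell2 R k}).
Proof. by move=> y; rewrite normr0. Qed.

(* Choose orthonormal bases starting with [u] and with the direction of
   [B (S (A u))]: the complementary block is again of the form [B' S A']. *)
Lemma op_det_le n (D : R) (x : X) (A : {linear ell2 R n.+1 -> X})
    (B : {linear Y -> ell2 R n.+1}) (u : ell2 R n.+1) :
  ubound (attained_dets n) D -> inscribed x A -> contraction B -> `|u| = 1 ->
  `|op_det (B \o S \o A)| <= `|B (S (A u))| * D.
Proof.
move=> ubD [Zx Fx AF] cB u1.
pose M : 'M[R]_n.+1 := lin1_mx (B \o S \o A : 'rV_n.+1 -> 'rV_n.+1).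
rewrite /op_det -/M.
have ME (v : 'rV_n.+1) : v *m M = B (S (A v)).
  exact: (mul_ell2_lin1 (B \o S \o A) v).
have [T0|T0] := eqVneq (B (S (A u))) 0.
  rewrite T0 normr0 mul0r (_ : \det M = 0) ?normr0//; apply/eqP/det0P.
  by exists u; [rewrite -(@normr_eq0 _ (ell2 R n.+1)) u1 oner_neq0|rewrite ME].
set tau := `|B (S (A u))|.
have tau0 : tau != 0 by rewrite normr_eq0.
pose w : ell2 R n.+1 := tau^-1 *: B (S (A u)).
have w1 : `|w| = 1 by rewrite normrZ normfV normr_id mulVf.
have [P [PT PP Pu]] := symmetric_orthogonal_row0 u1.
have [Q [QT QQ Qw]] := symmetric_orthogonal_row0 w1.
have [N NE] : exists N : 'M[R]_(1 + n), N = P *m M *m Q by eexists.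
have detN : `|\det N| = `|\det M|.
  rewrite NE (@det_mulmx _ n.+1) det_mulmx !normrM.
  by rewrite (norm_det_involutive PP) (norm_det_involutive QQ) mul1r mulr1.
(* [P] sends the first basis vector to [u], and [Q] sends the direction [w] of [B (S (A u))] back to
   it. Hence [N] is block lower triangular with corner [tau], and its lower right block comes from
   [A] on the complement of [u] and [B] without the coordinate along [w]. *)
have rowN : row 0 N = tau *: delta_mx 0 0.
  rewrite NE rowE (_ : delta_mx 0 0 *m (P *m M *m Q) = u *m M *m Q).
    rewrite ME (_ : B (S (A u)) = tau *: w :> 'rV_n.+1).
      by rewrite -scalemxAl -Qw -mulmxA QQ mulmx1.
    by rewrite scalerA mulfV// scale1r.
  by rewrite !mulmxA Pu.
have Nul : ulsubmx N = tau%:M.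
  apply/matrixP => i j; rewrite !ord1 !mxE.
  have /rowP/(_ 0) := rowN; rewrite !mxE !eqxx mulr1 mulr1n => <-.
  by congr (N _ _); exact: val_inj.
have Nur : ursubmx N = 0.
  apply/matrixP => i j; rewrite !ord1 !mxE.
  have /rowP/(_ (rshift 1 j)) := rowN; rewrite !mxE !eqxx.
  by rewrite -(inj_eq val_inj)/= mulr0 => <-; congr (N _ _); exact: val_inj.
rewrite -detN -(submxK N) Nul Nur det_lblock det_scalar expr1 normrM.
rewrite ger0_norm ?normr_ge0// ler_wpM2l ?normr_ge0//; apply: ubD.
have lA (f : {linear ell2 R n.+1 -> X}) :
    linear (fun v : ell2 R n =>
              f (row_mx (0 : 'rV_1) (v : 'rV_n) *m P : 'rV_n.+1)).
  move=> a v1 v2; rewrite -linearP; congr (f _).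
  rewrite scalemxAl -mulmxDl (@scale_row_mx _ 1 1 n) (@add_row_mx _ 1 1 n).
  by rewrite scaler0 addr0.
have lB (f : {linear Y -> ell2 R n.+1}) :
    linear (fun y => @rsubmx _ 1 1 n (f y *m Q) : ell2 R n).
  move=> a y1 y2; rewrite linearP /=.
  by rewrite mulmxDl -scalemxAl linearP.
have [A' A'E] := linear_existsP (lA A).
have [B' B'E] := linear_existsP (lB B).
exists x, A', B'; split.
- split=> // v v1; rewrite A'E; apply: AF.
  rewrite ell2_norm_mul_orthogonal//.
  by rewrite (ell2_norm_row_mx0 v).
- move=> y; rewrite B'E; apply: le_trans (cB y).
  rewrite -[leRHS](ell2_norm_mul_orthogonal _ QT QQ).
  set z : 'rV_n.+1 := B y *m Q.
  rewrite -(ler_pXn2r (_ : 0 < 2)%N) ?nnegrE//.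
  rewrite -[in leRHS](@hsubmxK _ 1 1 n z) [lsubmx _]mx11_scalar.
  by rewrite sqr_ell2_row_mx lerDr sqr_ge0.
- congr (`| \det _ |); apply/row_matrixP => i.
  apply/rowP => j; rewrite !mxE /= B'E /= A'E.
  rewrite -ME -delta_mx_rshift -!mulmxA (mulmxA P) -NE -rowE.
  by rewrite !mxE; congr (N _ _); exact: val_inj.
Qed.

End Determinants.

(** * Enlarging a compression by one dimension *)

Section Extension.
Variables (R : realType) (X Y : normedModType R) (S : {linear X -> Y}).

(* [cB k] is the factor lost when [B] is enlarged so as to see the residual
   [S g - L g] of a new direction [g]. *)
Definition codomain_extension (cB : nat -> R) :=
  forall k (A : {linear ell2 R k -> X}) (B : {linear Y -> ell2 R k}),
  contraction B -> op_det (B \o S \o A) != 0 ->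
  exists2 L : {linear X -> Y}, finite_rank_ops k L &
  forall g, exists2 B' : {linear Y -> ell2 R k.+1}, contraction B' &
  forall a b (A' : {linear ell2 R k.+1 -> X}),
    (forall t (v : 'rV[R]_k), A' (row_mx t%:M v) = a *: A v + b *: (t *: g)) ->
    `|op_det (B' \o S \o A')| =
    `|a| ^+ k * `|b| * cB k * `|op_det (B \o S \o A)| * `|S g - L g|.

(** The right inverse [s] makes [h] onto, so the range of [W \o h] is the range of [W], spanned by
    the images of the [k] basis vectors. *)
Lemma finite_rank_factor k (W : {linear ell2 R k -> Y}) (h : X -> ell2 R k)
    (s : ell2 R k -> X) (C : R) :
  linear h -> cancel s h -> 0 <= C ->
  (forall g, `|W (h g)| <= C * `|g|) ->
  exists2 L : {linear X -> Y}, finite_rank_ops k L & L =1 W \o h.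
Proof.
move=> lh hK C0 WhC; have [L LE] : exists L : {linear X -> Y}, L =1 W \o h.
  by apply: linear_existsP => a u v; rewrite /= lh linearP.
exists L => //; split.
  by apply/bounded_opP; exists C => // g; rewrite LE; exact: WhC.
exists (fun i => W (delta_mx 0 i : 'rV[R]_k)); apply/seteqP; split.
  move=> _ [g _ <-]; exists (fun i => (h g : 'rV[R]_k) 0 i) => //.
  rewrite LE /= [in RHS](row_sum_delta (h g : 'rV[R]_k)) linear_sum.
  by apply: eq_bigr => i _; rewrite linearZ.
move=> _ [c _ <-]; exists (s (\row_i c i : 'rV[R]_k)) => //.
rewrite LE /= hK [in LHS](row_sum_delta (\row_i c i)) linear_sum.
by apply: eq_bigr => i _; rewrite linearZ /= mxE.
Qed.

Lemma lin1_mx_block k (f : {linear ell2 R k.+1 -> ell2 R k.+1})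
    (p : R) (q : 'rV[R]_k) (c : 'cV[R]_k) (M : 'M[R]_k) :
  (forall t (v : 'rV[R]_k),
    f (row_mx t%:M v) = row_mx (t *: p%:M + v *m c) (t *: q + v *m M)) ->
  op_det f = \det (block_mx p%:M q c M).
Proof.
move=> fE; rewrite /op_det; apply: (congr1 determinant); apply/row_matrixP => i.
rewrite !rowE mul_ell2_lin1; set e : 'rV[R]_k.+1 := delta_mx 0 i.
rewrite -[e](@hsubmxK _ 1 1 k) [lsubmx _]mx11_scalar.
rewrite fE (@mul_row_block _ 1 1 k 1 k).
by rewrite !mul_scalar_mx.
Qed.


(* [alpha k ^ k * beta k] is the maximum of [a ^ k * b] on the unit circle. *)
Definition alpha k : R := Num.sqrt (k%:R / k.+1%:R).
Definition beta k : R := (Num.sqrt k.+1%:R)^-1.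

Lemma alpha_beta_sqr k : alpha k ^+ 2 + beta k ^+ 2 = 1.
Proof.
rewrite exprVn !sqr_sqrtr ?divr_ge0 ?ler0n// -[X in _ + X]div1r -mulrDl.
by rewrite -natr1 divff// natr1 pnatr_eq0.
Qed.

Lemma alpha_ge0 k : 0 <= alpha k.
Proof. exact: sqrtr_ge0. Qed.

Lemma beta_gt0 k : 0 < beta k.
Proof. by rewrite invr_gt0 sqrtr_gt0 ltr0n. Qed.

(** [L g] interpolates: it is the element of the range of [S \o A] with [B (L g) = B (S g)]. The new
    coordinate of [B'] is a functional norming the residual. The weights [alpha] and [beta] keep
    [B'] a contraction because their squares sum to 1. *)
Lemma codomain_extension_normed :
  bounded_op S -> codomain_extension (fun k => alpha k ^+ k * beta k).
Proof.
move=> /bounded_opP[CS CS0 CSE] k A B cB detT.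
pose M : 'M[R]_k := lin1_mx (B \o S \o A : 'rV_k -> 'rV_k).
have ME (v : 'rV_k) : v *m M = B (S (A v)).
  exact: (mul_ell2_lin1 (B \o S \o A) v).
have uM : M \in unitmx by rewrite unitmxE unitfE.
pose h g : ell2 R k := (B (S g) : 'rV_k) *m invmx M.
pose W : {linear ell2 R k -> Y} := S \o A.
have hM g : (h g : 'rV_k) *m M = B (S g) by rewrite mulmxKV.
(* [L = V \o B \o S], where [V] is bounded since its domain is finite dimensional. *)
have [V VE] : exists V : {linear ell2 R k -> Y},
    V =1 fun u => W ((u : 'rV_k) *m invmx M : 'rV_k).
  by apply: linear_existsP => a u v; rewrite mulmxDl -scalemxAl linearP.
have [CV CV0 CVE] := (bounded_opP V).1 (ell2_bounded_op V).
have [||||L Lfin LE] := @finite_rank_factor k W h A (CV * CS).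
- by move=> a u v; rewrite /h !linearP /= mulmxDl -scalemxAl.
- by move=> v; rewrite /h -ME mulmxK.
- exact: mulr_ge0.
- move=> g; rewrite -[W _]VE; apply: le_trans (CVE _) _.
  by rewrite -mulrA ler_wpM2l//; exact: le_trans (cB _) _.
exists L => // g.
have [bf [bf1 bfr]] := norming_functional (S g - L g).
have [B' B'E] : exists B' : {linear Y -> ell2 R k.+1}, B' =1 fun y =>
    row_mx (beta k * bf y)%:M (alpha k *: (B y : 'rV_k)) : 'rV_k.+1.
  apply: linear_existsP => a y z.
  rewrite (linearP bf) (linearP B) scalerDr.
  rewrite (@scale_row_mx _ 1 1 k) (@add_row_mx _ 1 1 k).
  congr (@row_mx _ 1 1 k _ _); last by rewrite !scalerA mulrC.
  by rewrite scale_scalar_mx -raddfD /=; congr (_%:M); rewrite mulrDr mulrCA.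
exists B'.
  move=> y; rewrite B'E -(ler_pXn2r (_ : 0 < 2)%N) ?nnegrE//.
  rewrite (@sqr_ell2_row_mx _ k (beta k * bf y) (alpha k *: B y)).
  rewrite normrZ !exprMn real_normK ?num_real//.
  rewrite -[leRHS]mul1r -(alpha_beta_sqr k) mulrDl addrC lerD//.
    by rewrite ler_wpM2l ?sqr_ge0// ler_pXn2r ?nnegrE.
  rewrite ler_wpM2l ?sqr_ge0// -[leLHS]real_normK ?num_real//.
  by rewrite ler_pXn2r ?nnegrE.
move=> a b A' A'E.
pose c : 'cV[R]_k := \col_i bf (W (delta_mx 0 i : 'rV[R]_k)).
have cE (v : 'rV_k) : v *m c = (bf (W v))%:M.
  rewrite [LHS]mx11_scalar mxE [in RHS](row_sum_delta v) !linear_sum.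
  congr (_%:M); apply: eq_bigr => i _.
  by rewrite !linearZ /= !mxE.
rewrite (@lin1_mx_block k _ (beta k * b * bf (S g))
  ((alpha k * b) *: (B (S g) : 'rV_k)) ((beta k * a) *: c)
  ((alpha k * a) *: M)); last first.
  move=> t v; rewrite /= A'E B'E; congr (@row_mx _ 1 1 k _ _).
    rewrite -scalemxAr cE !scale_scalar_mx -raddfD /=; congr (_%:M).
    by rewrite !linearD !linearZ /=; rewrite /GRing.scale /=; ring.
  rewrite -scalemxAr ME !linearD !linearZ /= !scalerA addrC.
  by congr (_ *: _ + _ *: _); ring.
(* Row elimination: subtracting the combination [h g] of the rows of [A] from the row of [g]
   replaces [S g] by [S g - L g], which [B] annihilates. *)
rewrite (_ : block_mx _ _ _ _ =
  block_mx b%:M (b *: (h g : 'rV_k)) 0 a%:M *m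
  block_mx (beta k * bf (S g - L g))%:M 0 (beta k *: c) (alpha k *: M)); last first.
  rewrite mulmx_block !mul0mx !mulmx0 !add0r !mul_scalar_mx.
  rewrite -!scalemxAr -!scalemxAl cE hM !scalerA !scale_scalar_mx -raddfD /=.
  congr (block_mx _%:M (_ *: _) (_ *: _) (_ *: _)); try ring.
  by rewrite linearB LE /=; ring.
rewrite det_mulmx det_ublock det_lblock !det_scalar !expr1 detZ bfr.
rewrite !normrM !normrX normr_id (ger0_norm (alpha_ge0 _)).
rewrite (gtr0_norm (beta_gt0 _)) /op_det -/M; ring.
Qed.

Lemma codomain_extension_hilbert :
  is_hilbert Y -> bounded_op S -> codomain_extension (fun=> 1).
Proof.
move=> [_ [dot dotE]] /bounded_opP[CS CS0 CSE] k A B cB detT.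
have dC y z : dot y z = dot z y by rewrite hermC expr0 mul1r.
have dP z a y1 y2 : dot (a *: y1 + y2) z = a * dot y1 z + dot y2 z.
  by rewrite linearPl.
have dZ z a y : dot (a *: y) z = a * dot y z by rewrite linearZl_LR.
have dD z y1 y2 : dot (y1 + y2) z = dot y1 z + dot y2 z by rewrite linearDl.
have dB z y1 y2 : dot (y1 - y2) z = dot y1 z - dot y2 z by rewrite linearBl.
have d0 z : dot 0 z = 0 by rewrite -(subrr 0) dB subrr.
pose M : 'M[R]_k := lin1_mx (B \o S \o A : 'rV_k -> 'rV_k).
have ME (v : 'rV_k) : v *m M = B (S (A v)).
  exact: (mul_ell2_lin1 (B \o S \o A) v).
pose W : {linear ell2 R k -> Y} := S \o A.
pose w i : Y := W (delta_mx 0 i : 'rV[R]_k).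
have dW (u : 'rV_k) z : dot (W u) z = \sum_i u 0 i * dot (w i) z.
  rewrite [in LHS](row_sum_delta u) linear_sum.
  rewrite (big_morph (dot^~ z) (dD z) (d0 z)).
  by apply: eq_bigr => i _; rewrite linearZ dZ.
pose v (y : Y) : 'rV[R]_k := \row_i dot y (w i).
have vE y (u : 'rV_k) : (v y *m u^T) 0 0 = dot y (W u).
  by rewrite dC dW mxE; apply: eq_bigr => i _; rewrite dC !mxE mulrC.
pose G : 'M[R]_k := \matrix_i v (w i).
have GE (u : 'rV_k) : u *m G = v (W u).
  by apply/rowP => i; rewrite !mxE dW; apply: eq_bigr => j _; rewrite !mxE.
(* The Gram matrix is invertible because [W] is injective, the determinant of [B \o S \o A] being
   nonzero. *)
have uG : G \in unitmx.
  rewrite unitmxE unitfE; apply/det0P => -[u u0 uG0].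
  have /eqP Wu : W u == 0.
    by rewrite -normr_eq0 -sqrf_eq0 -dotE -vE -GE uG0 mul0mx mxE.
  by move/det0P : detT; apply; exists u => //; rewrite -/M ME [S _]Wu linear0.
pose p y := W (v y *m invmx G).
have orth y (u : 'rV_k) : dot (y - p y) (W u) = 0.
  by rewrite dB -!vE -GE mulmxKV// subrr.
have dnormD q z : dot q z = 0 -> `|q + z| ^+ 2 = `|q| ^+ 2 + `|z| ^+ 2.
  move=> qz; rewrite -!dotE dD dC dD (dC z) qz addr0.
  by rewrite [X in _ + X]dC dD qz add0r.
have pyth y : `|y| ^+ 2 = `|y - p y| ^+ 2 + `|p y| ^+ 2.
  rewrite -dnormD ?subrK//; exact: orth.
have [||||L Lfin LE] :=
    @finite_rank_factor k W (fun g => v (S g) *m invmx G) A CS.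
- move=> a y z; rewrite linearP scalemxAl -mulmxDl; congr (_ *m _).
  by apply/rowP => i; rewrite !mxE dP.
- by move=> u; rewrite -[S _]/(W u) -GE mulmxK.
- by [].
- move=> g; apply: le_trans (CSE g); rewrite -(ler_pXn2r (_ : 0 < 2)%N) ?nnegrE//.
  by rewrite [leRHS]pyth lerDr sqr_ge0.
exists L => // g.
pose r := S g - L g; pose e := `|r|^-1 *: r.
(* Only an inequality: a zero residual gives [e = 0], as the inverse of 0 is 0. *)
have e1 : `|e| ^+ 2 <= 1.
  rewrite normrZ normfV normr_id; have [->|r0] := eqVneq `|r| 0.
    by rewrite mulr0 expr0n.
  by rewrite mulVf// expr1n.
have oW u : dot (W u) e = 0.
  by rewrite dC dZ /r LE orth mulr0.
have Sge : dot (S g) e = `|r|.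
  rewrite -(subrK (L g) (S g)) dD [L g in X in _ + X]LE oW addr0 -/r.
  rewrite dC dZ dotE expr2; have [->|r0] := eqVneq `|r| 0.
    by rewrite !mulr0.
  by rewrite mulKf.
move: e e1 oW Sge => e e1 oW Sge.
have [B' B'E] : exists B' : {linear Y -> ell2 R k.+1}, B' =1 fun y =>
    row_mx (dot y e)%:M (B (y - dot y e *: e) : 'rV_k) : 'rV_k.+1.
  apply: linear_existsP => a y z.
  rewrite (@scale_row_mx _ 1 1 k) (@add_row_mx _ 1 1 k).
  congr (@row_mx _ 1 1 k _ _).
    by rewrite scale_scalar_mx -raddfD /= dP.
  rewrite -linearP dP; congr (B _).
  by rewrite scalerBr scalerDl scalerA opprD addrACA.
exists B'.
  move=> y; rewrite B'E -(ler_pXn2r (_ : 0 < 2)%N) ?nnegrE//.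
  rewrite (@sqr_ell2_row_mx _ k (dot y e) (B (y - dot y e *: e))).
  apply: (@le_trans _ _ (dot y e ^+ 2 + `|y - dot y e *: e| ^+ 2)).
    by rewrite lerD2l ler_pXn2r ?nnegrE.
  have -> : `|y - dot y e *: e| ^+ 2 =
      `|y| ^+ 2 - 2 * dot y e ^+ 2 + dot y e ^+ 2 * `|e| ^+ 2.
    rewrite -dotE dB dZ (dC y) (dC e) !dB !dZ !dotE (dC e y); ring.
  by have := sqr_ge0 (dot y e); nra.
move=> a b A' A'E.
(* [e] is orthogonal to the range of [W], so the lower left block vanishes. *)
rewrite (@lin1_mx_block k _ (b * `|r|)
  (b *: (B (S g - `|r| *: e) : 'rV_k)) 0 (a *: M)); last first.
  move=> t u.
  have SE : S (a *: A u + b *: (t *: g)) = a *: W u + (b * t) *: S g.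
    by rewrite linearD !linearZ /= scalerA.
  rewrite /= A'E B'E SE dD !dZ oW Sge mulr0 add0r.
  congr (@row_mx _ 1 1 k _ _).
    by rewrite mulmx0 addr0 scale_scalar_mx; congr (_%:M); ring.
  rewrite -scalemxAr ME -addrA -[(b * t * _) *: e]scalerA -scalerBr linearD !linearZ /=.
  by rewrite addrC scalerA.
rewrite (@det_ublock _ 1 k) det_scalar expr1 detZ.
by rewrite !normrM normrX normr_id /op_det -/M; ring.
Qed.

End Extension.

(** * Enlarging an inscribed ellipsoid towards a point of a convex set *)

Section DomainExtension.
Variables (R : realType) (X : normedModType R) (F : set X).
Hypothesis F_convex :
  forall x y t, F x -> F y -> 0 <= t <= 1 -> F (t *: x + (1 - t) *: y).

(* [cA k] is the factor lost when the inscribed ellipsoid is enlarged by the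
   direction of a new point [f]. *)
Definition domain_extension (Z : set X) (cA : nat -> R) :=
  forall k x (A : {linear ell2 R k -> X}) f, inscribed F Z x A -> F f ->
  exists a b x' (A' : {linear ell2 R k.+1 -> X}),
    [/\ inscribed F Z x' A',
        forall t (v : 'rV[R]_k),
          A' (row_mx t%:M v) = a *: A v + b *: (t *: (f - x)) &
        `|a| ^+ k * `|b| = cA k].

(** The point lies on a segment from the ellipsoid to [f], with weight [t] on [f]; for [t = 1] it is
    [f] itself. *)
Lemma convex_inscribed k x (A : {linear ell2 R k -> X}) f v t :
  (forall u, `|u| <= 1 -> F (A u + x)) -> F f -> 0 <= t -> `|v| <= 1 - t ->
  F (A v + (1 - t) *: x + t *: f).
Proof.
move=> AF Ff t0 vt; have [t1|t1] := eqVneq t 1.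
  move: vt; rewrite t1 subrr normr_le0 => /eqP ->.
  by rewrite linear0 scale0r !add0r scale1r.
have st0 : 0 < 1 - t.
  by rewrite lt_neqAle (le_trans _ vt)// eq_sym subr_eq0 eq_sym t1.
rewrite addrC (_ : A v + _ = (1 - t) *: (A ((1 - t)^-1 *: v) + x)).
  apply: F_convex => //; last by rewrite t0 -subr_ge0 ltW.
  apply: AF; rewrite normrZ normfV (gtr0_norm st0).
  by rewrite ler_pdivrMl// mulr1.
by rewrite scalerDr linearZ scalerA mulfV ?gt_eqF// scale1r.
Qed.

Lemma extension_exists k (A : {linear ell2 R k -> X}) (a b : R) (g : X) :
  exists A' : {linear ell2 R k.+1 -> X},
    forall t (v : 'rV[R]_k), A' (row_mx t%:M v) = a *: A v + b *: (t *: g).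
Proof.
have [|A' A'E] := @linear_existsP R (ell2 R k.+1) X (fun u =>
    a *: A (@rsubmx _ 1 1 k u) + b *: (@lsubmx _ 1 1 k u 0 0 *: g)).
  move=> c u v; rewrite !linearP /= !mxE !scalerDl !scalerDr !scalerA addrACA.
  by rewrite !(mulrC c) -!mulrA.
exists A' => t v; rewrite A'E row_mxKr row_mxKl.
by rewrite mxE mulr1n.
Qed.

Lemma ell2_split k (u : ell2 R k.+1) :
  exists t (v : ell2 R k),
    u = row_mx t%:M (v : 'rV[R]_k) /\ `|u| ^+ 2 = t ^+ 2 + `|v| ^+ 2.
Proof.
pose t := @lsubmx _ 1 1 k u 0 0; pose v : ell2 R k := @rsubmx _ 1 1 k u.
have uE : u = row_mx t%:M (v : 'rV[R]_k).
  by rewrite -[LHS](@hsubmxK _ 1 1 k u) [lsubmx _]mx11_scalar.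
by exists t, v; split=> //; rewrite [in LHS]uE sqr_ell2_row_mx.
Qed.

Lemma cauchy_unit (a b s t : R) : 0 <= a -> 0 <= b -> 0 <= s ->
  s ^+ 2 + t ^+ 2 <= 1 -> (a * s + b * t) ^+ 2 <= a ^+ 2 + b ^+ 2.
Proof.
move=> a0 b0 s0 st.
have h1 : 0 <= (a * t - b * s) ^+ 2 by exact: sqr_ge0.
have h2 : 0 <= (a ^+ 2 + b ^+ 2) * (1 - (s ^+ 2 + t ^+ 2)).
  by rewrite mulr_ge0 ?subr_ge0// addr_ge0 ?sqr_ge0.
by nra.
Qed.

(** The center moves by [b (f - x)], which keeps the weight [b + b t] of [f] nonnegative for
    [|t| <= 1]. The new ellipsoid fits because [alpha^2 + 2 b = 1]: by Cauchy-Schwarz, [(alpha |v| +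
    b t)^2 <= alpha^2 + b^2 = (1 - b)^2]. *)
Lemma domain_extension_convex :
  domain_extension F (fun k => alpha R k ^+ k * (2 * k.+1%:R)^-1).
Proof.
move=> k x A f [_ Fx AF] Ff; set b : R := (2 * k.+1%:R)^-1.
have k0 : 0 < k.+1%:R :> R by rewrite ltr0n.
have b0 : 0 < b by rewrite invr_gt0 mulr_gt0.
have ab : alpha R k ^+ 2 + 2 * b = 1.
  rewrite sqr_sqrtr ?divr_ge0// /b invfM mulrA mulfV ?pnatr_eq0// mul1r.
  by rewrite -[X in _ + X]div1r -mulrDl natr1 divff// gt_eqF.
have b1 : b <= 1 by have := sqr_ge0 (alpha R k); nra.
have [A' A'E] := extension_exists A (alpha R k) b (f - x).
have A'F (u : ell2 R k.+1) : `|u| <= 1 -> F (A' u + (x + b *: (f - x))).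
  move=> u1; have [t [v [uE un]]] := ell2_split u.
  have tv : `|v| ^+ 2 + t ^+ 2 <= 1 by rewrite addrC -un expr_le1.
  have tb : -1 <= t <= 1.
    by rewrite -ler_norml -(@expr_le1 _ 2)// real_normK ?num_real//; nra.
  pose g := b + b * t.
  rewrite uE A'E (_ : _ + _ = A (alpha R k *: v) + (1 - g) *: x + g *: f).
    apply: convex_inscribed => //; first by rewrite /g; nra.
    rewrite normrZ ger0_norm ?alpha_ge0//.
    have := cauchy_unit (alpha_ge0 R k) (ltW b0) (normr_ge0 v) tv.
    move=> h; rewrite -subr_ge0 /g.
    suff : alpha R k * `|v| + b * t <= 1 - b by lra.
    apply: le_trans (ler_norm _) _.
    rewrite -(ler_pXn2r (_ : 0 < 2)%N) ?nnegrE ?subr_ge0//.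
    by rewrite real_normK ?num_real//; nra.
  rewrite [A (_ *: _)]linearZ /= -!addrA; congr (_ + _).
  rewrite addrCA scalerA -scalerDl addrC (addrC (b * t)) -/g.
  by rewrite scalerBr scalerBl scale1r addrC addrA addrAC.
have A'0 : F (x + b *: (f - x)).
  by rewrite -[_ + _]add0r -[0](linear0 A'); apply: A'F; rewrite normr0.
exists (alpha R k), b, (x + b *: (f - x)), A'; split=> //.
by rewrite ger0_norm ?alpha_ge0// ger0_norm// ltW.
Qed.

(** Since both [f] and [- f] lie in [F], the center stays at 0 and the sign of [t] selects the
    endpoint. The condition [alpha |v| + beta |t| <= 1] is Cauchy-Schwarz, which allows the larger
    semi-axis [beta]. *)
Lemma domain_extension_symmetric : (forall x, F x -> F (- x)) ->
  domain_extension [set 0] (fun k => alpha R k ^+ k * beta R k).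
Proof.
move=> FN k x A f [-> F0 AF] Ff.
have [A' A'E] := extension_exists A (alpha R k) (beta R k) f.
exists (alpha R k), (beta R k), 0, A'; rewrite subr0; split=> //; last first.
  by rewrite ger0_norm ?alpha_ge0// gtr0_norm// beta_gt0.
split=> // u u1; have [t [v [uE un]]] := ell2_split u.
have tv : `|v| ^+ 2 + `|t| ^+ 2 <= 1.
  by rewrite real_normK ?num_real// addrC -un expr_le1.
pose g := beta R k * `|t|; pose f' := if 0 <= t then f else - f.
rewrite uE A'E (_ : _ + _ = A (alpha R k *: v) + (1 - g) *: 0 + g *: f').
  apply: convex_inscribed => //; first by rewrite /f'; case: ifP => // _; exact: FN.
    by rewrite mulr_ge0// ltW// beta_gt0.
  rewrite normrZ ger0_norm ?alpha_ge0// lerBrDr.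
  have := cauchy_unit (alpha_ge0 R k) (ltW (beta_gt0 R k)) (normr_ge0 v) tv.
  by rewrite alpha_beta_sqr expr_le1// addr_ge0 ?mulr_ge0 ?alpha_ge0// ltW// beta_gt0.
rewrite scaler0 !addr0 [A (_ *: _)]linearZ /=; congr (_ + _); rewrite /g /f' scalerA.
case: (lerP 0 t) => t0; first by rewrite ger0_norm.
by rewrite ltr0_norm// mulrN scaleNr scalerN opprK.
Qed.

End DomainExtension.

(** * Comparison of approximation and Hilbert numbers *)

Lemma ereal_lt_between (R : realType) (x : R) (y : \bar R) :
  (x%:E < y)%E -> exists2 r, x < r & (r%:E < y)%E.
Proof.
case: y => [y| |//]; last by exists (x + 1); rewrite ?ltry// ltrDl.
rewrite lte_fin => xy; exists ((x + y) / 2); rewrite ?lte_fin.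
  by rewrite midf_lt.
by rewrite midf_lt.
Qed.

Section Numbers.
Variables (R : realType) (X Y : normedModType R) (S : {linear X -> Y}).
Variables (F Z : set X).

Lemma finite_rank_ops_subset k : finite_rank_ops k `<=` @finite_rank_ops R X Y k.+1.
Proof.
move=> L [Lb [v rL]]; split=> //.
(* The spanning family is padded with the zero vector at index 0. *)
exists (fun i => oapp v 0 (unlift ord0 i)); rewrite rL; apply/seteqP; split.
  move=> _ [c _ <-]; exists (fun i => oapp c 0 (unlift ord0 i)) => //.
  rewrite big_ord_recl unlift_none scale0r add0r.
  by apply: eq_bigr => i _; rewrite !liftK.
move=> _ [c _ <-]; exists (c \o lift ord0) => //.
rewrite big_ord_recl unlift_none scaler0 add0r.
by apply: eq_bigr => i _; rewrite !liftK.
Qed.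

Lemma approx_number_on_nonincreasing k n : (k <= n)%N ->
  (approx_number_on n S F <= approx_number_on k S F)%E.
Proof.
elim: n => [|n IH]; first by rewrite leqn0 => /eqP ->.
rewrite leq_eqVlt => /predU1P[-> //|]; rewrite ltnS => /IH; apply: le_trans.
apply: ereal_inf_le_tmp => _ [y _ [L Lfin <-]].
by exists y => //; exists L => //; exact: finite_rank_ops_subset.
Qed.

Lemma hilbert_number_ge n (x : X) (A : {linear ell2 R n.+1 -> X})
    (B : {linear Y -> ell2 R n.+1}) (s : R) :
  inscribed F Z x A -> contraction B ->
  (forall u, `|u| = 1 -> s <= `|B (S (A u))|) ->
  (s%:E <= hilbert_number n S F)%E.
Proof.
move=> [_ Fx AF] cB sT; apply: le_ereal_sup_tmp.
exists (approx_number n (B \o S \o A)); last exact: lower_bound_approx_number.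
exists A, x, B; split=> //.
- exact: ell2_bounded_op.
- by split=> // _ [u u1 <-]; exact: AF.
- by apply/bounded_opP; exists 1 => // y; rewrite mul1r.
- apply: ge_ereal_sup => _ [y y1 <-]; rewrite lee_fin.
  exact: le_trans (cB y) y1.
Qed.

(** Taking the constant [y0 = S x - L x] in the approximation number gives a point [f] of [F] whose
    residual in the direction [f - x] exceeds [a]; both extensions are then applied to this
    direction. *)
Lemma attained_dets_step (cA cB : nat -> R) k d a :
  codomain_extension S cB -> domain_extension F Z cA ->
  0 < cA k -> 0 < cB k -> attained_dets S F Z k d -> 0 < d ->
  (a%:E < approx_number_on k S F)%E ->
  exists2 d', attained_dets S F Z k.+1 d' & cA k * cB k * d * a < d'.
Proof.
move=> codE domE cA0 cB0 [x [A [B [iA cB' ->]]]]; rewrite normr_gt0 => d0 ak.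
have [L Lfin HL] := codE _ _ _ cB' d0.
have : (a%:E < ereal_sup [set `|S f - L f - (S x - L x)|%:E | f in F])%E.
  apply: lt_le_trans ak _; apply: ereal_inf_lbound.
  by exists (S x - L x) => //; exists L.
move=> /ereal_sup_gt[_ [f Ff <-]]; rewrite lte_fin => af.
have [B' cB'' B'E] := HL (f - x).
have [p [q [x' [A' [iA' A'E pq]]]]] := domE _ _ _ _ iA Ff.
exists `|op_det (B' \o S \o A')|; first by exists x', A', B'.
rewrite (B'E _ _ _ A'E) pq -!mulrA !ltr_pM2l// ?normr_gt0//.
suff -> : S (f - x) - L (f - x) = S f - L f - (S x - L x) by [].
by rewrite (linearB S) (linearB L) !opprD addrACA.
Qed.

Lemma approx_number_on_le (cA cB : nat -> R) (C : R) n :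
  bounded_set (S @` F) -> (exists2 x, Z x & F x) ->
  codomain_extension S cB -> domain_extension F Z cA ->
  (forall k, 0 < cA k) -> (forall k, 0 < cB k) ->
  0 < C -> 1 <= C * (cA n * cB n) ->
  (approx_number_on n S F <= C%:E * hilbert_number n S F)%E.
Proof.
move=> SFb [x0 Zx0 Fx0] codE domE cA0 cB0 C0 C1.
have h0 : (0 <= hilbert_number n S F)%E.
  apply: (@hilbert_number_ge n x0 \0 \0 0) => //; first exact: inscribed0.
  exact: contraction0.
(* If the conclusion failed, some [r] would lie strictly between [C h] and the approximation number,
   while [key] and [C1] give [r <= C h]. *)
suff key r : 0 < r -> (r%:E < approx_number_on n S F)%E ->
    ((cA n * cB n * r)%:E <= hilbert_number n S F)%E.
  rewrite leNgt; apply/negP.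
  case hE : (hilbert_number n S F) h0 key => [h| |] // h0 key; last first.
    by rewrite mulry gtr0_sg// mul1e ltNge leey.
  rewrite -EFinM => /ereal_lt_between[r hr ra].
  have h0' : 0 <= h by rewrite -lee_fin.
  have r0 : 0 < r by apply: le_lt_trans hr; rewrite mulr_ge0// ltW.
  have := key r r0 ra; rewrite lee_fin => kr.
  have : C * (cA n * cB n * r) <= C * h by rewrite ler_pM2l.
  by rewrite mulrA; nra.
move=> r0 /ereal_lt_between[r' rr' r'a].
have r'0 : 0 < r' by exact: lt_trans rr'.
pose dets k := attained_dets S F Z k.
(* The induction starts from the empty determinant, which is 1. It continues because the
   approximation numbers up to index [n] all exceed [r']. *)
have pos k : (k <= n)%N -> exists2 d, dets k d & 0 < d.
  elim: k => [_|k IH kn].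
    exists 1 => //; exists x0, \0, \0; split.
    - exact: inscribed0.
    - exact: contraction0.
    - by rewrite /op_det det_mx00 normr1.
  have [d kd d0] := IH (ltnW kn).
  have r'k : (r'%:E < approx_number_on k S F)%E.
    exact: lt_le_trans r'a (approx_number_on_nonincreasing (ltnW kn)).
  have [d' kd' dd'] :=
    attained_dets_step codE domE (cA0 k) (cB0 k) kd d0 r'k.
  exists d' => //; apply: lt_trans dd'.
  by rewrite !mulr_gt0.
have [d1 nd1 d10] := pos n (leqnn n).
have ubn : has_ubound (dets n) := attained_dets_bounded _ _ SFb.
set D := sup (dets n).
have D0 : 0 < D by apply: lt_le_trans d10 _; apply: ub_le_sup.
(* The gap between [r] and [r'] absorbs the failure of [D] to be attained: [d * r'] still exceeds
   [D * r]. *)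
have [d nd dD] : exists2 d, dets n d & r / r' * D < d.
  apply: sup_gt; first by exists d1.
  by rewrite gtr_pMl// ltr_pdivrMr// mul1r.
have d0 : 0 < d by apply: lt_trans dD; rewrite mulr_gt0// divr_gt0.
have [_ [x [A [B [iA cB' ->]]]]] :=
  attained_dets_step codE domE (cA0 n) (cB0 n) nd d0 r'a.
move=> detT; apply: (hilbert_number_ge iA cB') => u u1.
have uD : ubound (dets n) D by move=> e ne; exact: ub_le_sup.
(* The determinant of size [n + 1] is above [cA n * cB n * r * D] and at most [|B (S (A u))| * D];
   the factor [D] cancels. *)
rewrite -(ler_pM2r D0); apply/ltW.
apply: lt_le_trans (op_det_le uD iA cB' u1).
apply: le_lt_trans detT.
rewrite -!mulrA ler_pM2l// ler_pM2l// -ler_pdivrMr//.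
by apply: ltW; rewrite mulrAC.
Qed.

End Numbers.

(** * Estimates of the numerical constants *)

Section Constants.
Variables (R : realType) (n : nat).
Let q : R := alpha R n ^+ n.
Let s : R := Num.sqrt n.+1%:R.
Let E : R := expR (1 / 2).

Lemma expR1_sqr : expR 1 = E ^+ 2.
Proof. by rewrite -expRM_natl mulrC divfK ?pnatr_eq0. Qed.

(* [alpha n ^ (2 n) = (1 + 1 / n) ^ (- n) >= 1 / e]. *)
Lemma alpha_expn_ge : 1 <= E * q.
Proof.
have q0 : 0 <= q by rewrite exprn_ge0 ?alpha_ge0.
rewrite -(ler_pXn2r (_ : 0 < 2)%N) ?nnegrE ?mulr_ge0 ?expR_ge0//.
rewrite expr1n exprMn -expR1_sqr.
rewrite -exprM mulnC exprM sqr_sqrtr ?divr_ge0//.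
case: n => [|m]; first by rewrite expr0 mulr1 -expR0 ler_expR.
have m0 : 0 < m.+1%:R :> R by rewrite ltr0n.
have -> : expR 1 = expR (m.+1%:R^-1) ^+ m.+1 :> R.
  by rewrite -expRM_natl divff// gt_eqF.
rewrite -exprMn exprn_ege1// mulrA ler_pdivlMr ?ltr0n// mul1r [leRHS]mulrC.
have : m.+1%:R * (1 + m.+1%:R^-1) <= m.+1%:R * expR (m.+1%:R^-1) :> R.
  by rewrite ler_pM2l// expR_ge1Dx.
by rewrite mulrDr mulr1 divff ?gt_eqF// natr1.
Qed.

Lemma alpha_expn_gt0 k : 0 < alpha R k ^+ k.
Proof.
(* [alpha R 0] is 0, but its power with exponent 0 is 1. *)
case: k => [|k]; first by rewrite expr0.
by rewrite exprn_gt0// sqrtr_gt0 divr_gt0.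
Qed.

Lemma natr_sqrt : n.+1%:R = s ^+ 2.
Proof. by rewrite sqr_sqrtr. Qed.

Let E0 : 0 < E. Proof. exact: expR_gt0. Qed.
Let E1 : 1 <= E. Proof. by rewrite -expR0 ler_expR. Qed.
Let s0 : 0 < s. Proof. by rewrite sqrtr_gt0. Qed.

Lemma constant_convex : 1 <= 2 * expR (3 / 2) * n.+1%:R `^ (3 / 2) *
  (q * (2 * n.+1%:R)^-1 * (q * beta R n)).
Proof.
have -> : expR (3 / 2) = E ^+ 3 by rewrite -expRM_natl mulrA mulr1.
have -> : n.+1%:R `^ (3 / 2) = s ^+ 3 :> R.
  by rewrite mulrC powRrM powR12_sqrt// powR_mulrn.
rewrite natr_sqrt /beta -/s.
(* All powers of [s] cancel; the remaining factor [E] is merely bounded below by 1. *)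
rewrite (_ : _ * _ = E * (E * q) ^+ 2); last by field; rewrite gt_eqF.
by rewrite -[1](mulr1 1) ler_pM// exprn_ege1// alpha_expn_ge.
Qed.

Lemma constant_convex_hilbert :
  1 <= 2 * expR 1 * n.+1%:R * (q * (2 * n.+1%:R)^-1 * 1).
Proof.
rewrite expR1_sqr natr_sqrt.
rewrite (_ : _ * _ = E * (E * q)); last by field; rewrite gt_eqF.
by rewrite -[1](mulr1 1) ler_pM// alpha_expn_ge.
Qed.

Lemma constant_symmetric :
  1 <= expR 1 * n.+1%:R * (q * beta R n * (q * beta R n)).
Proof.
rewrite expR1_sqr natr_sqrt /beta -/s.
rewrite (_ : _ * _ = (E * q) ^+ 2); last by field; rewrite gt_eqF.
by rewrite exprn_ege1// alpha_expn_ge.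
Qed.

Lemma constant_symmetric_hilbert :
  1 <= Num.sqrt (expR 1 * n.+1%:R) * (q * beta R n * 1).
Proof.
rewrite expR1_sqr natr_sqrt -exprMn sqrtr_sqr gtr0_norm ?mulr_gt0//.
rewrite /beta -/s.
have -> : E * s * (q / s * 1) = E * q by field; rewrite gt_eqF.
exact: alpha_expn_ge.
Qed.

End Constants.

Unset Implicit Arguments.
Set Strict Implicit.

Theorem theorem7 (R : realType) (X Y : normedModType R) (S : {linear X -> Y})
    (S_bounded : bounded_op S) (F : set X) (F_nonempty : F !=set0)
    (F_convex : convex_set (F : set (convex_lmodType X)))
    (SF_bounded : bounded_set (S @` F)) (n : nat) :
  [/\ (approx_number_on n S F <=
         (2 * expR (3 / 2) * n.+1%:R `^ (3 / 2))%:E * hilbert_number n S F)%E,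
      is_hilbert Y ->
      (approx_number_on n S F <=
         (2 * expR 1 * n.+1%:R)%:E * hilbert_number n S F)%E,
      F = [set - x | x in F] ->
      (approx_number_on n S F <=
         (expR 1 * n.+1%:R)%:E * hilbert_number n S F)%E &
      F = [set - x | x in F] -> is_hilbert Y ->
      (approx_number_on n S F <=
         (Num.sqrt (expR 1 * n.+1%:R))%:E * hilbert_number n S F)%E].
Proof.
have cF := convex_setE F_convex.
have a0 k : 0 < alpha R k ^+ k by exact: alpha_expn_gt0.
have b0 k : 0 < alpha R k ^+ k * beta R k by rewrite mulr_gt0// beta_gt0.
have c0 k : 0 < alpha R k ^+ k * (2 * k.+1%:R)^-1.
  by rewrite mulr_gt0// invr_gt0 mulr_gt0.
have FF : exists2 x, F x & F x by case: F_nonempty => x; exists x.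
have codE := codomain_extension_normed S_bounded.
have domE := domain_extension_convex cF.
have symN : F = [set - x | x in F] -> forall x, F x -> F (- x).
  by move=> FE x Fx; rewrite FE; exists x.
(* A symmetric convex set contains 0, the midpoint of [x] and [- x], so the center can be fixed
   there. *)
have sym0 : F = [set - x | x in F] -> exists2 x, [set 0] x & F x.
  move=> FE; have [x Fx] := F_nonempty; exists 0 => //.
  have := cF _ _ (1 / 2) Fx (symN FE _ Fx).
  have -> : 1 - 1 / 2 = 1 / 2 :> R by field.
  by rewrite scalerN subrr; apply; lra.
split=> [|HY|FE|FE HY].
- apply: (approx_number_on_le SF_bounded FF codE domE c0 b0).
    by rewrite !mulr_gt0 ?expR_gt0 ?powR_gt0.
  exact: constant_convex.
- apply: (approx_number_on_le SF_bounded FF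
    (codomain_extension_hilbert HY S_bounded) domE c0 (fun=> ltr01)).
    by rewrite !mulr_gt0 ?expR_gt0.
  exact: constant_convex_hilbert.
- apply: (approx_number_on_le SF_bounded (sym0 FE) codE
    (domain_extension_symmetric cF (symN FE)) b0 b0).
    by rewrite !mulr_gt0 ?expR_gt0.
  exact: constant_symmetric.
- apply: (approx_number_on_le SF_bounded (sym0 FE)
    (codomain_extension_hilbert HY S_bounded)
    (domain_extension_symmetric cF (symN FE)) b0
    (fun=> ltr01)).
    by rewrite sqrtr_gt0 !mulr_gt0 ?expR_gt0.
  exact: constant_symmetric_hilbert.
Qed.
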